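(* If $M$ is a compact hyperbolic manifold, then $c(M)=2$, where $c(M)$ is the cop win number of $M$.
   Context: A compact hyperbolic manifold is a compact (connected, boundaryless) Riemannian manifold of constant sectional curvature $-1$ of some dimension $n\ge 2$; equivalently it is a compact quotient $\mathbb{H}^n/\Gamma$, where $\mathbb{H}^n$ is hyperbolic $n$-space and $\Gamma$ is a group of isometries of $\mathbb{H}^n$ acting freely and properly discontinuously. It is a geodesic space with its Riemannian distance $d$ (any two points $x,y$ are joined by a path of length $d(x,y)$). The Cops and Robber game on a geodesic space $(X,d)$ with $k$ cops $c_1,\dots,c_k$ and one robber $r$: at the beginning the robber chooses an agility function $\tau:\mathbb{N}\to\mathbb{R}_+$ with $\sum_{n\ge 1}\tau(n)=\infty$ and initial positions $r^0,c_1^0,\dots,c_k^0\in X$ of all players. In round $n\ge 1$, first the robber moves from $r^{n-1}$ to a point $r^n$ with $d(r^{n-1},r^n)\le\tau(n)$, and then, knowing this, each cop $c_i$ moves from $c_i^{n-1}$ to a point $c_i^n$ with $d(c_i^{n-1},c_i^n)\le\tau(n)$. All positions and $\tau$ are known to all players. The cops win the game if $\inf_{n,i} d(c_i^n,r^n)=0$. The cop win number $c(X)$ is the minimum $k$ such that $k$ cops can win the game on $X$, regardless of the robber's strategy, agility function and choice of initial positions. *)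

(* Defs.v *)
From HB Require Import structures.
From mathcomp Require Import all_boot all_order all_algebra.
From mathcomp Require Import all_classical all_reals all_analysis.
From mathcomp Require Import ring lra.

Set Implicit Arguments.
Unset Strict Implicit.
Unset Printing Implicit Defensive.

Import Order.TTheory GRing.Theory Num.Theory.
Import numFieldNormedType.Exports.

Local Open Scope classical_set_scope.
Local Open Scope ring_scope.

(** * Hyperbolic space: the hyperboloid model *)

Definition arcosh (R : realType) (t : R) : R := ln (t + Num.sqrt (t ^+ 2 - 1)).

(* Coordinate 0 is the time coordinate. *)
Definition lorentz (R : realType) (n : nat) (x y : 'rV[R]_n.+1) : R :=
  \sum_(i < n) x 0 (lift ord0 i) * y 0 (lift ord0 i) - x 0 0 * y 0 0.

Record hyperbolic (R : realType) (n : nat) : Type := Hyperbolic {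
  hpoint :> 'rV[R]_n.+1 ;
  hpointP : (lorentz hpoint hpoint == - 1) && (0 < hpoint 0 0) }.

HB.instance Definition _ (R : realType) (n : nat) :=
  [isSub for @hpoint R n].
HB.instance Definition _ (R : realType) (n : nat) :=
  [Choice of hyperbolic R n by <:].

Definition hdist (R : realType) (n : nat) (x y : hyperbolic R n) : R :=
  arcosh (- lorentz x y).

Section HyperbolicMetric.
Context {R : realType} {n : nat}.
Implicit Types (x y z s t : 'rV[R]_n.+1) (a b c : R).

Let dot x y : R := \sum_(i < n) x 0 (lift ord0 i) * y 0 (lift ord0 i).

Lemma lorentzC x y : lorentz x y = lorentz y x.
Proof.
rewrite /lorentz [x 0 0 * _]mulrC; congr (_ - _).
by apply: eq_bigr => i _; rewrite mulrC.
Qed.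

Lemma lorentz_linear a x y z :
  lorentz (a *: x + y) z = a * lorentz x z + lorentz y z.
Proof.
rewrite /lorentz !mxE mulrBr mulr_sumr.
have -> : \sum_(i < n) (a *: x + y) 0 (lift ord0 i) * z 0 (lift ord0 i) =
  \sum_(i < n) a * (x 0 (lift ord0 i) * z 0 (lift ord0 i)) +
  \sum_(i < n) y 0 (lift ord0 i) * z 0 (lift ord0 i).
  by rewrite -big_split; apply: eq_bigr => i _; rewrite !mxE /=; ring.
ring.
Qed.

Let discriminant a b c : 0 <= a ->
  (forall t : R, 0 <= a * t ^+ 2 + 2 * b * t + c) -> b ^+ 2 <= a * c.
Proof.
rewrite le_eqVlt => /orP[/eqP<- H|a0 H]; last first.
  have := H (- b / a).
  have -> : a * (- b / a) ^+ 2 + 2 * b * (- b / a) + c = (a * c - b ^+ 2) / a.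
    by field; rewrite gt_eqF.
  by rewrite pmulr_lge0 ?invr_gt0// subr_ge0.
have [->|b0] := eqVneq b 0; first by rewrite mul0r expr0n.
have := H (- (c + 1) / (2 * b)).
have -> : 0 * (- (c + 1) / (2 * b)) ^+ 2 + 2 * b * (- (c + 1) / (2 * b)) + c = -1.
  by field.
by rewrite ler0N1.
Qed.

Let dot_ge0 x : 0 <= dot x x.
Proof. by apply: sumr_ge0 => i _; rewrite -expr2 sqr_ge0. Qed.

Let cauchy_dot x y : dot x y ^+ 2 <= dot x x * dot y y.
Proof.
apply: discriminant => // t.
have -> : dot x x * t ^+ 2 + 2 * dot x y * t + dot y y =
  \sum_(i < n) (t * x 0 (lift ord0 i) + y 0 (lift ord0 i)) ^+ 2.
  rewrite /dot mulr_suml mulr_sumr mulr_suml -!big_split.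
  by apply: eq_bigr => i _ /=; ring.
by apply: sumr_ge0 => i _; rewrite sqr_ge0.
Qed.

Let lorentzE x y : lorentz x y = dot x y - x 0 0 * y 0 0.
Proof. by []. Qed.

Let orthogonal_time s (y : hyperbolic R n) : lorentz s y = 0 ->
  (s 0 0) ^+ 2 <= lorentz s s * (hpoint y 0 0 ^+ 2 - 1).
Proof.
move: (hpointP y) => /andP[/eqP]; rewrite !lorentzE => yy y0 /eqP.
rewrite subr_eq0 => /eqP sy; have := cauchy_dot s y; rewrite sy.
have -> : dot y y = hpoint y 0 0 ^+ 2 - 1 by rewrite expr2; lra.
by rewrite exprMn; nra.
Qed.

Let hpoint0_ge1 (y : hyperbolic R n) : 1 <= hpoint y 0 0 ^+ 2.
Proof.
have /andP[/eqP] := hpointP y; rewrite lorentzE => yy y0.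
by have := dot_ge0 y; rewrite expr2; lra.
Qed.

Lemma lorentz_orthogonal_ge0 s (y : hyperbolic R n) :
  lorentz s y = 0 -> 0 <= lorentz s s.
Proof.
move=> sy; have := orthogonal_time sy; have := hpoint0_ge1 y.
rewrite le_eqVlt => /orP[/eqP <-|y1].
  rewrite subrr mulr0 => s0; rewrite lorentzE.
  by have := dot_ge0 s; rewrite -expr2; lra.
move=> h; have := le_trans (sqr_ge0 _) h.
by rewrite pmulr_lge0 // subr_gt0.
Qed.

Lemma lorentz_orthogonal_eq0 s (y : hyperbolic R n) :
  lorentz s y = 0 -> lorentz s s = 0 -> s = 0.
Proof.
move=> sy ss; have := orthogonal_time sy; rewrite ss mul0r => s02.
have /eqP : (s 0 0) ^+ 2 = 0 by apply/eqP; rewrite eq_le s02 sqr_ge0.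
rewrite expf_eq0 /= => /eqP s0.
have ds : dot s s = 0 by move: ss; rewrite lorentzE s0 mul0r subr0.
apply/rowP => j; rewrite mxE; case: (unliftP ord0 j) => [i ->|->//].
have /eqP := ds; rewrite psumr_eq0; last by move=> ? _; rewrite -expr2 sqr_ge0.
by move=> /allP /(_ i (mem_index_enum _)) /=; rewrite -expr2 expf_eq0 => /eqP.
Qed.

Let lorentz_hh (x : hyperbolic R n) : lorentz x x = -1.
Proof. by have /andP[/eqP] := hpointP x. Qed.

Lemma lorentz_ge1 (x y : hyperbolic R n) : 1 <= - lorentz x y.
Proof.
have /andP[_ x0] := hpointP x; have /andP[_ y0] := hpointP y.
have dx : dot x x = hpoint x 0 0 ^+ 2 - 1.
  by have := lorentz_hh x; rewrite lorentzE expr2; lra.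
have dy : dot y y = hpoint y 0 0 ^+ 2 - 1.
  by have := lorentz_hh y; rewrite lorentzE expr2; lra.
have := cauchy_dot x y; rewrite dx dy lorentzE.
have := dot_ge0 x; have := dot_ge0 y; rewrite dx dy.
set a := hpoint x 0 0 in x0 *; set b := hpoint y 0 0 in y0 *; set d := dot x y.
move=> b1 a1 dab.
have a1' : 1 <= a by nra.
have b1' : 1 <= b by nra.
have ab1 : 0 <= a * b - 1 by nra.
have : d ^+ 2 <= (a * b - 1) ^+ 2.
  apply: le_trans dab _; rewrite -subr_ge0.
  have -> : (a * b - 1) ^+ 2 - (a ^+ 2 - 1) * (b ^+ 2 - 1) = (a - b) ^+ 2 by ring.
  exact: sqr_ge0.
rewrite -[X in X <= _]real_normK ?num_real//.
rewrite ler_pXn2r ?nnegrE// => h.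
by have := le_trans (ler_norm d) h; lra.
Qed.

(* The Gram determinant inequality, i.e., Cauchy-Schwarz on the orthogonal of
   y. *)
Let lorentz_gram (x y z : hyperbolic R n) :
  (- lorentz x z - lorentz x y * lorentz y z) ^+ 2 <=
  (lorentz x y ^+ 2 - 1) * (lorentz y z ^+ 2 - 1).
Proof.
pose u := - lorentz x y; pose v := - lorentz y z; pose w := - lorentz x z.
rewrite -[lorentz x y * _]mulrNN -(sqrrN (lorentz x y)) -(sqrrN (lorentz y z)).
rewrite -/u -/v -/w.
pose x' := (- u) *: hpoint y + hpoint x.
pose z' := (- v) *: hpoint y + hpoint z.
have zy : lorentz z y = - v by rewrite /v opprK lorentzC.
have yx : lorentz y x = - u by rewrite /u opprK lorentzC.
have xy : lorentz x y = - u by rewrite /u opprK.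
have yz : lorentz y z = - v by rewrite /v opprK.
have xz : lorentz x z = - w by rewrite /w opprK.
have x'y : lorentz x' y = 0 by rewrite lorentz_linear lorentz_hh xy; ring.
have z'y : lorentz z' y = 0 by rewrite lorentz_linear lorentz_hh zy; ring.
have xx' : lorentz x' x' = u ^+ 2 - 1.
  rewrite [LHS]lorentz_linear (lorentzC y) x'y (lorentzC x) lorentz_linear.
  by rewrite lorentz_hh yx; ring.
have zz' : lorentz z' z' = v ^+ 2 - 1.
  rewrite [LHS]lorentz_linear (lorentzC y) z'y (lorentzC z) lorentz_linear.
  by rewrite lorentz_hh yz; ring.
have xz' : lorentz x' z' = u * v - w.
  rewrite [LHS]lorentz_linear (lorentzC y) z'y (lorentzC x) lorentz_linear.
  by rewrite yx (lorentzC z) xz; ring.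
rewrite -sqrrN opprB -xx' -zz' -xz'; apply: discriminant => [|t].
  exact: lorentz_orthogonal_ge0 x'y.
clearbody x' z'; have txz : lorentz (t *: x' + z') y = 0 by rewrite lorentz_linear x'y z'y; ring.
have := lorentz_orthogonal_ge0 txz.
rewrite lorentz_linear (lorentzC x') (lorentzC z') !lorentz_linear.
rewrite (lorentzC z' x').
by congr (0 <= _); ring.
Qed.

Lemma arcosh1 : arcosh (1 : R) = 0.
Proof. by rewrite /arcosh expr1n subrr sqrtr0 addr0 ln1. Qed.

Lemma ler_arcosh a b : 1 <= a -> a <= b -> arcosh a <= arcosh b.
Proof.
move=> a1 ab; rewrite ler_ln ?posrE ?ltr_pwDl ?sqrtr_ge0//; try lra.
by rewrite lerD// ler_wsqrtr// lerB// ler_pXn2r// nnegrE; lra.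
Qed.

Lemma arcosh_eq0 a : 1 <= a -> arcosh a = 0 -> a = 1.
Proof.
move=> a1 h; apply/eqP; rewrite eq_le a1 andbT.
have s0 := sqrtr_ge0 (a ^+ 2 - 1).
have : a + Num.sqrt (a ^+ 2 - 1) <= 1.
  rewrite -ler_ln ?posrE ?ln1//; last by lra.
  by rewrite -/(arcosh a) h.
lra.
Qed.

Lemma arcoshD a b : 1 <= a -> 1 <= b -> arcosh a + arcosh b =
  arcosh (a * b + Num.sqrt (a ^+ 2 - 1) * Num.sqrt (b ^+ 2 - 1)).
Proof.
move=> a1 b1; have a2 : 0 <= a ^+ 2 - 1 by nra.
have b2 : 0 <= b ^+ 2 - 1 by nra.
have := sqr_sqrtr a2; have := sqr_sqrtr b2; rewrite /arcosh.
have := sqrtr_ge0 (a ^+ 2 - 1); have := sqrtr_ge0 (b ^+ 2 - 1).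
set A := Num.sqrt (a ^+ 2 - 1); set B := Num.sqrt (b ^+ 2 - 1).
move=> B0 A0 hB hA; rewrite -lnM ?posrE; [|by lra..].
congr ln.
have -> : (a * b + A * B) ^+ 2 - 1 = (a * B + b * A) ^+ 2.
  have -> : (a * b + A * B) ^+ 2 = a^+2 * b^+2 + 2 * a * b * A * B + A^+2 * B^+2.
    by ring.
  have -> : (a * B + b * A) ^+ 2 = a^+2 * B^+2 + 2 * a * b * A * B + b^+2 * A^+2.
    by ring.
  by rewrite hA hB; ring.
rewrite sqrtr_sqr ger0_norm; first by ring.
by apply: addr_ge0; apply: mulr_ge0 => //; lra.
Qed.

Lemma hdistxx (x : hyperbolic R n) : hdist x x = 0.
Proof. by rewrite /hdist lorentz_hh opprK arcosh1. Qed.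

Lemma hdist_positivity (x y : hyperbolic R n) : hdist x y = 0 -> x = y.
Proof.
move=> /(arcosh_eq0 (lorentz_ge1 x y)) /eqP; rewrite eqr_oppLR => /eqP xy.
apply: val_inj; apply/eqP; rewrite -subr_eq0; apply/eqP.
have e : hpoint x - hpoint y = (-1) *: hpoint y + hpoint x.
  by rewrite scaleN1r addrC.
have sy : lorentz (hpoint x - hpoint y) y = 0.
  by rewrite e lorentz_linear lorentz_hh xy; ring.
apply: lorentz_orthogonal_eq0 (sy) _.
rewrite {1}e lorentz_linear (lorentzC y) sy (lorentzC x) e lorentz_linear.
by rewrite lorentz_hh (lorentzC y) xy; ring.
Qed.

Lemma hdist_sym (x y : hyperbolic R n) : hdist x y = hdist y x.
Proof. by rewrite /hdist lorentzC. Qed.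

Lemma hdist_triangle (y x z : hyperbolic R n) :
  hdist x z <= hdist x y + hdist y z.
Proof.
have u1 := lorentz_ge1 x y; have v1 := lorentz_ge1 y z.
rewrite /hdist arcoshD//; apply: ler_arcosh; first exact: lorentz_ge1.
have := lorentz_gram x y z.
rewrite -[lorentz x y * _]mulrNN -(sqrrN (lorentz x y)) -(sqrrN (lorentz y z)).
set u := - lorentz x y in u1 *; set v := - lorentz y z in v1 *.
set w := - lorentz x z => g.
have u2 : 0 <= u ^+ 2 - 1 by nra.
rewrite addrC -lerBlDr -sqrtrM//; apply: le_trans (ler_norm _) _.
by rewrite -sqrtr_sqr ler_wsqrtr.
Qed.

End HyperbolicMetric.

HB.instance Definition _ (R : realType) (n : nat) :=
  isMetric.Build R (hyperbolic R n) (@hdistxx R n) (@hdist_positivity R n)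
    (@hdist_sym R n) (@hdist_triangle R n).

(** * Compact hyperbolic manifolds *)

Definition isometry_group (R : realType) (X : metricType R)
    (G : set (X -> X)) : Prop :=
  [/\ G id,
      (forall f g, G f -> G g -> G (f \o g)),
      (forall f, G f -> exists2 g, G g & cancel f g /\ cancel g f) &
      (forall f, G f -> forall x y, mdist (f x) (f y) = mdist x y)].

Definition acts_freely (T : Type) (G : set (T -> T)) : Prop :=
  forall f x, G f -> f x = x -> f = id.

Definition acts_properly_discontinuously (T : topologicalType)
    (G : set (T -> T)) : Prop :=
  forall K : set T, compact K ->
    finite_set [set f | G f /\ (f @` K) `&` K !=set0].

(* M is isometric to the orbit space X / G, with p the orbit projection.  The
   Riemannian distance between two orbits is the infimum of the distances
   between their points, which can be computed with one point fixed since G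
   acts by isometries. *)
Definition is_orbit_space (R : realType) (X : metricType R) (G : set (X -> X))
    (M : metricType R) : Prop :=
  exists p : X -> M,
    [/\ (forall m, exists x, p x = m),
        (forall x y, p x = p y <-> exists2 g, G g & y = g x) &
        (forall x y, mdist (p x) (p y) = inf [set mdist x (g y) | g in G])].

Definition compact_hyperbolic_manifold (R : realType) (n : nat)
    (M : metricType R) : Prop :=
  compact [set: M] /\
  exists G : set (hyperbolic R n -> hyperbolic R n),
    [/\ isometry_group G, acts_freely G, acts_properly_discontinuously G &
        is_orbit_space G M].

(** * The game of Cops and Robber *)

(* tau n bounds the moves of round n >= 1; tau 0 is not used by the game. *)
Definition agility (R : realType) (tau : nat -> R) : Prop :=
  (forall n, 0 <= tau n) /\
  (\sum_(1 <= i < n.+1) tau i)@[n --> \oo] --> +oo.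

Section Game.
Context {R : realType} (X : metricType R) (k : nat).

(* The position of the robber and those of the k cops. *)
Definition position : Type := (X * ('I_k -> X))%type.

(* Strategies see the past positions, most recent first; the strategy of the
   cops is moreover given the new position of the robber. *)
Definition robber_strategy : Type := seq position -> X.
Definition cop_strategy : Type := seq position -> X -> 'I_k -> X.

(* A history p :: h made of n positions precedes the move of round n. *)
Definition legal_robber (tau : nat -> R) (rho : robber_strategy) : Prop :=
  forall (p : position) (h : seq position),
    mdist p.1 (rho (p :: h)) <= tau (size (p :: h)).

Definition legal_cops (tau : nat -> R) (sigma : cop_strategy) : Prop :=
  forall (p : position) (h : seq position) (r : X) (i : 'I_k),
    mdist (p.2 i) (sigma (p :: h) r i) <= tau (size (p :: h)).

Fixpoint history (p0 : position) (sigma : cop_strategy)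
    (rho : robber_strategy) (n : nat) : seq position :=
  if n is m.+1 then
    let h := history p0 sigma rho m in (rho h, sigma h (rho h)) :: h
  else [:: p0].

Definition position_after (p0 : position) (sigma : cop_strategy)
    (rho : robber_strategy) (n : nat) : position :=
  head p0 (history p0 sigma rho n).

(* The infimum is taken in the extended reals so that it is +oo, and the cops
   do not win, when there are no cops. *)
Definition cops_win_play (p0 : position) (sigma : cop_strategy)
    (rho : robber_strategy) : Prop :=
  ereal_inf [set (mdist ((position_after p0 sigma rho ni.1).2 ni.2)
                        (position_after p0 sigma rho ni.1).1)%:E
            | ni in [set: nat * 'I_k]] = 0%E.

Definition cops_can_win : Prop :=
  forall (tau : nat -> R) (p0 : position), agility tau ->
    exists2 sigma : cop_strategy, legal_cops tau sigma &
      forall rho : robber_strategy, legal_robber tau rho ->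
        cops_win_play p0 sigma rho.

End Game.

Definition is_cop_win_number (R : realType) (X : metricType R) (k : nat)
    : Prop :=
  cops_can_win X k /\ forall j, cops_can_win X j -> (k <= j)%N.

(* Main.v *)
Require Import Defs.
From mathcomp Require Import all_boot all_order all_algebra.
From mathcomp Require Import all_classical all_reals all_analysis.
From mathcomp Require Import ring lra.

(** Write M = H^n / G, let p be the projection, and lift all the motions to
    H^n.

    One cop is not enough.  Compactness, freeness and proper discontinuity give
    a positive injectivity radius, so p preserves small distances
    ([projection_isometric]).  With small constant agility e, a robber at
    distance at least e from a single cop can make that distance at least 2e by
    moving, if need be, along the geodesic that leaves the cop ([escape_single_pursuer]), and
    one cop move then leaves it at least e ([one_cop_cannot_win]).

    Two cops are enough.  Fix a base point o of H^n, the initial lift of the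
    first cop.  This cop, the chaser, always stays on the segment [o, r], where
    r is the lifted robber.  When the robber has agility t and its distance to o
    grows by d only, so that it loses t - d against running straight away from
    o, the chaser can shorten its own distance a to the robber by
    (1 - exp (- a)) (t - d), or catch it ([lion_step]): contracting the polar
    coordinates about o from the radius of the robber to that of the chaser
    shrinks tangential moves at least by the factor exp (- a), so the chaser
    keeps more of its agility for the radial direction.  If the chaser stays at
    distance at least delta, the total loss of the robber is hence finite, and
    in the long run the robber is almost running on a ray that starts at o.

    The second cop, the ambusher, exploits that this ray can be foreseen.  It
    plays in phases.  At the start of a phase it picks as target the point at
    distance 2 D beyond the robber on the ray from o through the robber, where D
    bounds the diameter of M.  It has enough agility to reach the projection of
    the target and waits there.  In the first round in which the agility spent
    during the phase exceeds 2 D it moves straight to the robber.  In a late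
    phase the loss of the robber is tiny, so at that moment the robber has just
    passed within any prescribed distance of the target ([overtake]), and the
    ambusher comes as close ([pursuit_succeeds]).

    All the estimates in H^n rest on the existence of points at prescribed
    distances on a geodesic ([geodesic_point]) and on the hyperbolic theorem of
    Stewart ([stewart]). *)

Set Implicit Arguments.
Unset Strict Implicit.
Unset Printing Implicit Defensive.

Import Order.TTheory GRing.Theory Num.Theory.
Import numFieldNormedType.Exports.

Local Open Scope classical_set_scope.
Local Open Scope ring_scope.

(** * Hyperbolic functions *)

Section HyperbolicFunctions.
Context {R : realType}.
Implicit Types x y a t : R.

Definition cosh x : R := (expR x + expR (- x)) / 2.
Definition sinh x : R := (expR x - expR (- x)) / 2.

Lemma cosh0 : cosh 0 = 1.
Proof. by rewrite /cosh oppr0 expR0; lra. Qed.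

Lemma sinh0 : sinh 0 = 0.
Proof. by rewrite /sinh oppr0 expR0; lra. Qed.

Lemma coshN x : cosh (- x) = cosh x.
Proof. by rewrite /cosh opprK addrC. Qed.

Lemma cosh_norm x : cosh `|x| = cosh x.
Proof. by case: (ler0P x) => // _; rewrite coshN. Qed.

Lemma coshD x y : cosh (x + y) = cosh x * cosh y + sinh x * sinh y.
Proof. by rewrite /cosh /sinh opprD !expRD; field. Qed.

Lemma coshB x y : cosh (x - y) = cosh x * cosh y - sinh x * sinh y.
Proof. by rewrite /cosh /sinh opprB addrC !expRD; field. Qed.

Lemma sinhD x y : sinh (x + y) = sinh x * cosh y + cosh x * sinh y.
Proof. by rewrite /cosh /sinh opprD !expRD; field. Qed.

Lemma sinhB x y : sinh (x - y) = sinh x * cosh y - cosh x * sinh y.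
Proof. by rewrite /cosh /sinh opprB [y - x]addrC !expRD; field. Qed.

Lemma cosh2Bsinh2 x : cosh x ^+ 2 - sinh x ^+ 2 = 1.
Proof.
rewrite -[RHS](expRxMexpNx_1 x) /cosh /sinh.
by move: (expR x) (expR (- x)) => u v; field.
Qed.

Lemma ltr_sinh x y : x < y -> sinh x < sinh y.
Proof.
move=> xy; have : expR x < expR y by rewrite ltr_expR.
have : expR (- y) < expR (- x) by rewrite ltr_expR ltrN2.
by rewrite /sinh; lra.
Qed.

Lemma ler_sinh x y : x <= y -> sinh x <= sinh y.
Proof. by rewrite le_eqVlt => /predU1P[->//|/ltr_sinh/ltW]. Qed.

Lemma sinh_ge0 x : 0 <= x -> 0 <= sinh x.
Proof. by move=> /ler_sinh; rewrite sinh0. Qed.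

Lemma sinh_gt0 x : 0 < x -> 0 < sinh x.
Proof. by move=> /ltr_sinh; rewrite sinh0. Qed.

Lemma cosh_ge1 x : 1 <= cosh x.
Proof.
rewrite /cosh; have := expRxMexpNx_1 x.
have := expR_gt0 x; have := expR_gt0 (- x).
move: (expR x) (expR (- x)) => u v v0 u0 uv.
have : 0 <= (u - v) ^+ 2 by exact: sqr_ge0.
rewrite expr2 ler_pdivlMr// mul1r => h; rewrite leNgt; apply/negP => uv2.
have : 0 < (2 - (u + v)) * (2 + (u + v)) by rewrite mulr_gt0//; lra.
by nra.
Qed.

Lemma ltr_cosh x y : 0 <= x -> x < y -> cosh x < cosh y.
Proof.
move=> x0 xy; have sxy := ltr_sinh xy; have sx := sinh_ge0 x0.
have := cosh2Bsinh2 x; have := cosh2Bsinh2 y.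
have := cosh_ge1 x; have := cosh_ge1 y.
by rewrite !expr2; move: sx sxy; nra.
Qed.

Lemma ler_cosh x y : `|x| <= y -> cosh x <= cosh y.
Proof.
rewrite -(cosh_norm x) le_eqVlt => /predU1P[->//|xy].
by rewrite ltW// ltr_cosh.
Qed.

Lemma ler_cosh_inv x y : 0 <= y -> cosh x <= cosh y -> x <= y.
Proof.
move=> y0; apply: contraTT; rewrite -!ltNge => yx; exact: ltr_cosh.
Qed.

Lemma cosh_inj x y : 0 <= x -> 0 <= y -> cosh x = cosh y -> x = y.
Proof.
by move=> x0 y0 xy; apply/eqP; rewrite eq_le; apply/andP; split;
  apply: ler_cosh_inv; rewrite // xy.
Qed.

(** The graph of exp lies above its tangent at the intermediate point. *)
Lemma expR_convex a x y : 0 <= a <= 1 ->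
  expR (x + a * (y - x)) <= expR x + a * (expR y - expR x).
Proof.
move=> /andP[a0 a1]; set z := x + _.
have tangent w : expR z * (1 + (w - z)) <= expR w.
  have -> : expR w = expR z * expR (w - z) by rewrite -expRD addrC subrK.
  rewrite ler_pM2l ?expR_gt0//.
  exact: expR_ge1Dx.
have ty := ler_wpM2l a0 (tangent y).
have a1' : 0 <= 1 - a by lra.
have tx := ler_wpM2l a1' (tangent x).
have : expR z = (1 - a) * (expR z * (1 + (x - z))) +
                a * (expR z * (1 + (y - z))) by rewrite /z; ring.
lra.
Qed.

Lemma cosh_convex a x y : 0 <= a <= 1 ->
  cosh (x + a * (y - x)) <= cosh x + a * (cosh y - cosh x).
Proof.
move=> a01; have := expR_convex x y a01; have := expR_convex (- x) (- y) a01.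
rewrite /cosh (_ : - x + _ = - (x + a * (y - x))); last by ring.
lra.
Qed.

Lemma sinh_contract a x : 0 <= a -> sinh (x - a) <= expR (- a) * sinh x.
Proof.
move=> a0; rewrite /sinh opprB (addrC a) !expRD.
have : expR (- a) <= expR a by rewrite ler_expR; lra.
have := expR_gt0 (- x); move: (expR (- a)) (expR a) (expR x) (expR (- x)).
by move=> u v w z; nra.
Qed.

Lemma coshD_ge x y : 0 <= x -> 0 <= y -> cosh x + cosh y - 1 <= cosh (x + y).
Proof.
move=> x0 y0; rewrite coshD.
have := sinh_ge0 x0; have := sinh_ge0 y0; have := cosh_ge1 x; have := cosh_ge1 y.
by nra.
Qed.

Lemma coshB_le x a : 0 <= a -> cosh x - cosh (x - a) <= a * expR x / 2.
Proof.
move=> a0; rewrite /cosh opprB (addrC a) !expRD.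
have : 1 <= expR a by rewrite -expR0 ler_expR.
have := expR_ge1Dx (- a).
have := expR_gt0 (- x); have := expR_gt0 x.
move: (expR (- a)) (expR a) (expR x) (expR (- x)).
by move=> u v w z; nra.
Qed.

Lemma expR_le_sinh a x : a <= x ->
  expR x * (1 - expR (- (2 * a))) / 2 <= sinh x.
Proof.
move=> ax; rewrite /sinh ler_pM2r ?invr_gt0// mulrBr mulr1 lerD2l lerN2 -expRD.
by rewrite ler_expR; lra.
Qed.

(** The computation behind [lion_step], for a base point o: rho, a and R' are
    the distances from o to the cop, from the cop to the robber, and from o to
    the new position of the robber; s is the length of the move of the robber
    and g the gap that the cop leaves.  The last hypothesis is what Stewart's
    theorem gives for the number B, the hyperbolic cosine of the length of the
    move of the cop.  It says that B is cosh of the radial part of this move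
    plus sinh rho * sinh (R' - g) / (sinh (rho + a) * sinh R') times
    cosh s - cosh (R' - (rho + a)), the tangential part of the move of the
    robber.  This coefficient is at most exp (- a), and convexity of cosh bounds
    the radial part. *)
Lemma lion_inequality a rho R' g s t B :
  0 < a -> 0 <= rho -> 0 <= g -> g < R' -> g <= a ->
  `|R' - (rho + a)| <= s -> s <= t ->
  a - g <= (1 - expR (- a)) * (t - (R' - (rho + a))) ->
  sinh (rho + a) * sinh R' * B = sinh g * (sinh (rho + a) * cosh rho) +
    sinh (R' - g) * (sinh a * cosh R' + sinh rho * cosh s) ->
  B <= cosh t.
Proof.
move=> a0 rho0 g0 gR ga Rs st ag EB.
have R0 : 0 < rho + a by lra.
have {}EB : sinh (rho + a) * sinh R' * B = sinh (rho + a) * sinh R' *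
    cosh (R' - (rho + a) + (a - g)) + sinh rho * sinh (R' - g) *
    (cosh s - cosh (R' - (rho + a))).
  rewrite EB.
  have {1}-> : g = R' - (R' - g) by ring.
  have {2}-> : a = (rho + a) - rho by ring.
  have -> : R' - (rho + a) + (a - g) = (R' - g) - rho by ring.
  move: (R' - g) (rho + a) => rho' r.
  by rewrite !(sinhB, coshB); ring.
have S0 := sinh_gt0 R0; have S'0 : 0 < sinh R' by apply: sinh_gt0; lra.
have sr0 := sinh_ge0 rho0.
have sr'0 : 0 <= sinh (R' - g) by apply: sinh_ge0; lra.
have sr' : sinh (R' - g) <= sinh R' by apply: ler_sinh; lra.
have sr : sinh rho <= expR (- a) * sinh (rho + a).
  by rewrite -[X in sinh X <= _](addrK a) sinh_contract// ltW.
have e1 : expR (- a) < 1 by rewrite -expR0 ltr_expR; lra.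
have Rt := le_trans Rs st.
have D : cosh (R' - (rho + a)) <= cosh t by exact: ler_cosh.
have sC : cosh s <= cosh t.
  by apply: ler_cosh; rewrite ger0_norm// (le_trans _ Rs).
have cD : cosh (R' - (rho + a) + (a - g)) <= cosh (R' - (rho + a)) +
    (1 - expR (- a)) * (cosh t - cosh (R' - (rho + a))).
  have x0 : 0 <= t - (R' - (rho + a)).
    by rewrite subr_ge0 (le_trans (ler_norm _)).
  move: (R' - (rho + a)) x0 D ag {EB Rs Rt} => d x0 D ag.
  (* k is the fraction of the loss t - d that the cop gains. *)
  pose k := (a - g) / (t - d).
  have kx : a - g = k * (t - d).
    have [x00|x00] := eqVneq (t - d) 0; last by rewrite /k divfK.
    by move: ag; rewrite x00 !mulr0; lra.
  have k0 : 0 <= k by rewrite divr_ge0//; lra.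
  have kk : k <= 1 - expR (- a).
    have [x00|x00] := eqVneq (t - d) 0; first by rewrite /k x00 invr0 mulr0; lra.
    by rewrite ler_pdivrMr// lt_neqAle eq_sym x00.
  have k1 : 0 <= k <= 1 by have := expR_gt0 (- a); rewrite k0; lra.
  rewrite kx; apply: le_trans (cosh_convex d t k1) _.
  by rewrite lerD2l ler_wpM2r// subr_ge0.
have SS := mulr_gt0 S0 S'0.
have K : sinh rho * sinh (R' - g) <= expR (- a) * (sinh (rho + a) * sinh R').
  by rewrite mulrA ler_pM.
rewrite -(ler_pM2l SS) EB.
move: (cosh (R' - (rho + a) + (a - g))) cD => C1 cD.
move: (cosh (R' - (rho + a))) D cD {EB Rs Rt ag} => C0 D cD.
move: (sinh (rho + a) * sinh R') (sinh rho * sinh (R' - g))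
  (mulr_ge0 sr0 sr'0) K SS => P Q Q0 K P0.
have b1 := ler_wpM2l (ltW P0) cD.
have b2 : Q * (cosh s - C0) <= Q * (cosh t - C0) by rewrite ler_wpM2l// lerD2r.
have b3 : Q * (cosh t - C0) <= expR (- a) * P * (cosh t - C0).
  by rewrite ler_wpM2r// subr_ge0.
lra.
Qed.

End HyperbolicFunctions.

(** * Geodesics of hyperbolic space *)

Section HyperbolicSpace.
Context {R : realType} {n : nat}.
Implicit Types o c r q x y z : hyperbolic R n.

Lemma cosh_mdist x y : cosh (mdist x y) = - lorentz x y.
Proof.
have B1 := lorentz_ge1 x y; rewrite /mdist /= /hdist /arcosh.
move: (- lorentz x y) B1 => B B1.
have s0 := sqrtr_ge0 (B ^+ 2 - 1).
have s2 : Num.sqrt (B ^+ 2 - 1) ^+ 2 = B ^+ 2 - 1.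
  by rewrite sqr_sqrtr//; nra.
move: (Num.sqrt (B ^+ 2 - 1)) s0 s2 => s s0 s2.
rewrite /cosh expRN lnK ?posrE; last by lra.
rewrite [X in _ + X](_ : _ = B - s); first by lra.
by apply: (mulfI (x := B + s)); [rewrite gt_eqF//; lra|rewrite divff ?gt_eqF; nra].
Qed.

Lemma lorentz0l (z : 'rV[R]_n.+1) : lorentz 0 z = 0.
Proof.
by rewrite /lorentz !mxE mul0r subr0 big1// => i _; rewrite mxE mul0r.
Qed.

Lemma lorentzZDl a b (x y z : 'rV[R]_n.+1) :
  lorentz (a *: x + b *: y) z = a * lorentz x z + b * lorentz y z.
Proof. by rewrite lorentz_linear -[b *: y]addr0 lorentz_linear lorentz0l addr0. Qed.

(** In Minkowski space, a point c of the geodesic segment from o to r is the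
    linear combination (sinh (d c r) o + sinh (d o c) r) / sinh (d o r):
    the difference is isotropic and orthogonal to c, hence zero.  Pairing with z
    gives the formula, which reduces all the computations with geodesics below
    to hyperbolic trigonometry. *)
Lemma stewart o c r z : mdist o r = mdist o c + mdist c r ->
  sinh (mdist o r) * cosh (mdist c z) =
  sinh (mdist c r) * cosh (mdist o z) + sinh (mdist o c) * cosh (mdist r z).
Proof.
move=> dE; have or := cosh_mdist o r; have oc := cosh_mdist o c.
have cr := cosh_mdist c r; have oo := cosh_mdist o o.
have rr := cosh_mdist r r; have cc := cosh_mdist c c.
rewrite !mdistxx cosh0 in oo rr cc.
rewrite !cosh_mdist.
move: (mdist o r) (mdist o c) (mdist c r) dE or oc cr => d a b dE or oc cr.
pose v := sinh d *: hpoint c + (- sinh b *: hpoint o + - sinh a *: hpoint r).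
have vE w : lorentz v w =
    sinh d * lorentz c w - sinh b * lorentz o w - sinh a * lorentz r w.
  by rewrite /v lorentz_linear lorentzZDl; ring.
have vc : lorentz v c = 0.
  rewrite vE (lorentzC r).
  have -> : lorentz c c = -1 by lra.
  have -> : lorentz o c = - cosh a by lra.
  have -> : lorentz c r = - cosh b by lra.
  by rewrite dE sinhD; ring.
have vo : lorentz v o = 0.
  rewrite vE (lorentzC c o) (lorentzC r o).
  have -> : lorentz o o = -1 by lra.
  have -> : lorentz o c = - cosh a by lra.
  have -> : lorentz o r = - cosh (a + b) by rewrite -dE; lra.
  rewrite dE sinhD coshD.
  transitivity (sinh b * (1 - (cosh a ^+ 2 - sinh a ^+ 2))); first by ring.
  by rewrite cosh2Bsinh2; ring.
have vr : lorentz v r = 0.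
  rewrite vE.
  have -> : lorentz r r = -1 by lra.
  have -> : lorentz c r = - cosh b by lra.
  have -> : lorentz o r = - cosh (a + b) by rewrite -dE; lra.
  rewrite dE sinhD coshD.
  transitivity (sinh a * (1 - (cosh b ^+ 2 - sinh b ^+ 2))); first by ring.
  by rewrite cosh2Bsinh2; ring.
have vv : lorentz v v = 0.
  by rewrite vE (lorentzC c) (lorentzC o) (lorentzC r) vc vo vr; ring.
have := vE z; rewrite (lorentz_orthogonal_eq0 vc vv) lorentz0l; lra.
Qed.

(** Two unit timelike vectors on the same sheet have a negative product: if v
    were on the other sheet, [lorentz_ge1] would apply to - v. *)
Lemma timelike_future (v : 'rV[R]_n.+1) o :
  lorentz v v = -1 -> lorentz v o < 0 -> 0 < v 0 0.
Proof.
move=> vv vo; rewrite lt_neqAle; apply/andP; split.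
  apply: contra_eqN vv => /eqP v0.
  rewrite /lorentz -v0 mul0r subr0 gt_eqF// (lt_le_trans (ltrN10 R))//.
  by apply: sumr_ge0 => i _; rewrite -expr2 sqr_ge0.
rewrite leNgt; apply/negP => v0.
have Nv w : lorentz (- v) w = - lorentz v w.
  by rewrite -[- v]addr0 -scaleN1r lorentz_linear lorentz0l; ring.
have vP : (lorentz (- v) (- v) == -1) && (0 < (- v) 0 0).
  by rewrite mxE oppr_gt0 v0 andbT Nv lorentzC Nv vv opprK.
by have := lorentz_ge1 (Hyperbolic vP) o; rewrite /= Nv opprK; lra.
Qed.

(** The point at distance t from o on the ray from o through r.  The absolute
    value covers both the points of the segment and those beyond r. *)
Lemma geodesic_point o r t : o != r -> 0 <= t ->
  exists2 x, mdist o x = t & mdist x r = `|mdist o r - t|.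
Proof.
rewrite -mdist_gt0 => d0 t0; have S0 := sinh_gt0 d0.
have := cosh_mdist o r.
have oo := cosh_mdist o o; have rr := cosh_mdist r r.
rewrite !mdistxx cosh0 in oo rr.
move: (mdist o r) d0 S0 => d d0 S0 or.
pose v := (sinh (d - t) / sinh d) *: hpoint o + (sinh t / sinh d) *: hpoint r.
have vE w : lorentz v w =
    (sinh (d - t) * lorentz o w + sinh t * lorentz r w) / sinh d.
  by rewrite /v lorentzZDl; ring.
have orE : lorentz o r = - cosh d by lra.
have ooE : lorentz o o = -1 by lra.
have rrE : lorentz r r = -1 by lra.
have vo : lorentz v o = - cosh t.
  rewrite vE ooE (lorentzC r) orE sinhB; field.
  by rewrite gt_eqF.
have vr : lorentz v r = - cosh (d - t).
  rewrite vE rrE orE sinhB coshB.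
  apply: (mulIf (lt0r_neq0 S0)); rewrite divfK ?gt_eqF//.
  transitivity (- sinh t * (1 - (cosh d ^+ 2 - sinh d ^+ 2)) -
    (cosh d * cosh t - sinh d * sinh t) * sinh d); first by ring.
  by rewrite cosh2Bsinh2; ring.
have vv : lorentz v v = -1.
  rewrite vE (lorentzC o) (lorentzC r) vo vr sinhB coshB.
  apply: (mulIf (lt0r_neq0 S0)); rewrite divfK ?gt_eqF//.
  transitivity (- sinh d * (cosh t ^+ 2 - sinh t ^+ 2)); first by ring.
  by rewrite cosh2Bsinh2; ring.
have v0 : 0 < v 0 0.
  apply: (timelike_future (o := o)) => //.
  by rewrite vo oppr_lt0 (lt_le_trans ltr01)// cosh_ge1.
have vP : (lorentz v v == -1) && (0 < v 0 0) by rewrite vv eqxx.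
exists (Hyperbolic vP); apply: cosh_inj; rewrite ?mdist_ge0//.
  by rewrite cosh_mdist lorentzC vo opprK.
by rewrite cosh_mdist cosh_norm vr opprK.
Qed.

(** One round of the chase from the segment [o, r].  The subtracted term is a
    fraction of what the robber loses against running straight away from o; the
    fraction depends on the current gap only, not on the distance to o, and it
    is this uniformity that makes the total loss finite. *)
Lemma lion_step o c r r' t :
  mdist o r = mdist o c + mdist c r -> mdist r r' <= t ->
  exists c', [/\ mdist o r' = mdist o c' + mdist c' r', mdist c c' <= t &
    mdist c' r' <= Num.max 0 (mdist c r -
      (1 - expR (- mdist c r)) * (t - (mdist o r' - mdist o r)))].
Proof.
move=> ocr rr't.
have t0 : 0 <= t by rewrite (le_trans _ rr't)// mdist_ge0.
have tri1 := metric_triangle o r r'; have tri2 := metric_triangle o r' r.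
rewrite (metric_sym r' r) in tri2.
(* A cop that has reached the robber follows it. *)
have [cr|cr] := eqVneq c r.
  by exists r'; rewrite cr !mdistxx addr0 le_max lexx.
have [or'|or'] := eqVneq o r'.
  exists r'; rewrite !mdistxx addr0 le_max lexx; split => //.
  move: rr't tri2; rewrite -or' mdistxx (metric_sym c).
  by have := mdist_ge0 c r; lra.
rewrite -mdist_gt0 in cr; have R'0 := or'; rewrite -mdist_gt0 in R'0.
have rho0 := mdist_ge0 o c.
pose g := Num.max 0 (mdist c r -
  (1 - expR (- mdist c r)) * (t - (mdist o r' - mdist o r))).
have k0 : 0 <= 1 - expR (- mdist c r).
  by rewrite subr_ge0 -expR0 ler_expR oppr_le0 ltW.
have kx0 : 0 <= (1 - expR (- mdist c r)) * (t - (mdist o r' - mdist o r)).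
  by rewrite mulr_ge0//; lra.
rewrite -/g; have [gR|Rg] := ltP g (mdist o r'); last first.
  (* The robber came so close to o that o itself is close enough to it. *)
  exists o; rewrite mdistxx add0r; split => //.
  by rewrite metric_sym; move: Rg; rewrite /g le_max; lra.
have g0 : 0 <= g by rewrite /g le_max lexx.
have ga : g <= mdist c r by rewrite /g ge_max mdist_ge0/=; lra.
have ag : mdist c r - g <=
    (1 - expR (- mdist c r)) * (t - (mdist o r' - mdist o r)).
  by rewrite lerBlDl -lerBlDr /g le_max lexx orbT.
clearbody g; have [|c' oc' cr'] := @geodesic_point o r' (mdist o r' - g) or'.
  by lra.
rewrite subKr ger0_norm// in cr'.
have oc'r : mdist o r' = mdist o c' + mdist c' r' by rewrite oc' cr' subrK.
exists c'; rewrite cr'; split => //; first by rewrite -cr'.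
apply: ler_cosh_inv => //.
apply: (@lion_inequality _ (mdist c r) (mdist o c) (mdist o r') g
  (mdist r r')) => //; rewrite -?ocr//.
  by rewrite ler_norml; lra.
have := stewart c oc'r; have := stewart r' ocr.
rewrite cr' oc' (metric_sym c' c) (metric_sym r' c).
move: (sinh (mdist o r)) (sinh (mdist o r')) (cosh (mdist c r')) => S S' C.
move: (cosh (mdist c c')) (cosh (mdist o c)) => B C1 SC SB.
transitivity (S * (S' * B)); first by rewrite mulrA.
rewrite SB mulrDr [in RHS]addrC -SC; ring.
Qed.

(** A robber that runs almost straight away from o passes close to the point q
    that lies ahead of it on its ray.  By Stewart's theorem, cosh (d q r')
    exceeds cosh (t - l) at most by eta times a constant; the bound
    delta <= d o r keeps this constant independent of o and r. *)
Lemma overtake (delta l e : R) : 0 < delta -> 0 < l -> 0 < e ->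
  exists2 eta, 0 < eta & forall o r q r' t,
    delta <= mdist o r -> mdist r q = l -> mdist o q = mdist o r + l ->
    l <= t <= 2 * l -> mdist r r' <= t -> mdist o r + t - eta <= mdist o r' ->
    mdist q r' <= t - l + e.
Proof.
move=> delta0 l0 e0.
(* exp x * w <= 2 sinh x for all x >= delta, see expR_le_sinh. *)
pose w := 1 - expR (- (2 * delta)); pose C := sinh l * expR (2 * l) / w.
have w0 : 0 < w by rewrite subr_gt0 -[ltRHS]expR0 ltr_expR; lra.
have C0 : 0 < C by rewrite divr_gt0// mulr_gt0 ?expR_gt0// sinh_gt0.
have ce : 0 < cosh e - 1 by rewrite subr_gt0 -cosh0 ltr_cosh.
exists (Num.min delta ((cosh e - 1) / C)) => [|o r q r' t].
  by rewrite lt_min delta0 divr_gt0.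
move eE : (Num.min _ _) => eta dR rq oq /andP[lt t2] rr' or'.
have eta0 : 0 < eta by rewrite -eE lt_min delta0 divr_gt0.
have etad : eta <= delta by rewrite -eE ge_min lexx.
have etaC : eta * C <= cosh e - 1.
  by rewrite -ler_pdivlMr// -eE ge_min lexx orbT.
have orq : mdist o q = mdist o r + mdist r q by rewrite rq.
have := stewart r' orq; rewrite oq rq.
move: (mdist o r) dR or' {orq oq} => R0 dR or' st.
have R00 := lt_le_trans delta0 dR; have S0 := sinh_gt0 R00.
have cr : cosh (mdist r r') <= cosh t by rewrite ler_cosh// ger0_norm ?mdist_ge0.
have co : cosh (R0 + t - eta) <= cosh (mdist o r').
  by rewrite ler_cosh// ger0_norm//; lra.
have cB := @coshB_le R (R0 + t) eta (ltW eta0).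
have sl := sinh_gt0 l0.
have expS : expR R0 * w / 2 <= sinh R0 by exact: expR_le_sinh.
have exp2 : expR t <= expR (2 * l) by rewrite ler_expR.
have key : sinh l * (cosh (R0 + t) - cosh (R0 + t - eta)) <=
    sinh R0 * (cosh e - 1).
  apply: le_trans (_ : _ <= sinh R0 * (eta * C)) _; last by rewrite ler_pM2l.
  apply: le_trans (ler_wpM2l (ltW sl) cB) _.
  apply: le_trans (_ : _ <= sinh l * (eta * (expR R0 * expR (2 * l)) / 2)) _.
    rewrite ler_pM2l// ler_pM2r ?invr_gt0// ler_pM2l// expRD.
    by rewrite ler_pM2l ?expR_gt0.
  rewrite [leLHS](_ : _ = expR R0 * w / 2 * (eta * C)).
    by rewrite ler_wpM2r// mulr_ge0// ltW.
  by rewrite /C; field; rewrite gt_eqF.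
have cq : cosh (mdist q r') <= cosh (t - l) + cosh e - 1.
  rewrite -(ler_pM2l S0).
  have -> : sinh R0 * cosh (mdist q r') =
      sinh (R0 + l) * cosh (mdist r r') - sinh l * cosh (mdist o r').
    by rewrite st; ring.
  have S1 := sinh_gt0 (addr_gt0 R00 l0).
  have e1 : sinh (R0 + l) * cosh (mdist r r') <= sinh (R0 + l) * cosh t.
    by rewrite ler_pM2l.
  have e2 : sinh l * cosh (R0 + t - eta) <= sinh l * cosh (mdist o r').
    by rewrite ler_pM2l.
  have E : sinh (R0 + l) * cosh t - sinh l * cosh (R0 + t) =
      sinh R0 * cosh (t - l).
    by rewrite [cosh (t - l)]coshB sinhD coshD; ring.
  by clear -e1 e2 E key; lra.
have tl : 0 <= t - l by rewrite subr_ge0.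
apply: ler_cosh_inv; first by rewrite addr_ge0// ltW.
by apply: le_trans cq _; apply: coshD_ge => //; exact: ltW.
Qed.

End HyperbolicSpace.

(** * Bounded subsets of hyperbolic space *)

Section CompactnessInHyperbolicSpace.
Context {R : realType} {n : nat}.
Implicit Types (u v : 'rV[R]_n) (x y : hyperbolic R n).

Let graph u : 'rV[R]_n.+1 :=
  \row_j if unlift ord0 j is Some i then u 0 i
         else Num.sqrt (1 + \sum_i u 0 i ^+ 2).

Let graph0 u : graph u 0 0 = Num.sqrt (1 + \sum_i u 0 i ^+ 2).
Proof. by rewrite mxE unlift_none. Qed.

Let graphS u i : graph u 0 (lift ord0 i) = u 0 i.
Proof. by rewrite mxE liftK. Qed.

Let sum_sqr_ge0 u : 0 <= \sum_i u 0 i ^+ 2.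
Proof. by apply: sumr_ge0 => i _; exact: sqr_ge0. Qed.

Let graph_lorentz u v : lorentz (graph u) (graph v) = \sum_i u 0 i * v 0 i -
  Num.sqrt (1 + \sum_i u 0 i ^+ 2) * Num.sqrt (1 + \sum_i v 0 i ^+ 2).
Proof.
by rewrite /lorentz !graph0; congr (_ - _); apply: eq_bigr => i _; rewrite !graphS.
Qed.

Fact graph_subproof u : (lorentz (graph u) (graph u) == -1) && (0 < graph u 0 0).
Proof.
have s0 := sum_sqr_ge0 u.
rewrite graph_lorentz graph0 sqrtr_gt0 ltr_pwDl// andbT -expr2 sqr_sqrtr; last lra.
apply/eqP; under eq_bigr do rewrite -expr2.
by ring.
Qed.

(** The hyperboloid is the graph of the time coordinate over the others. *)
Definition chart u : hyperbolic R n := Hyperbolic (graph_subproof u).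

Let chart_lorentz u v : lorentz (chart u) (chart v) = \sum_i u 0 i * v 0 i -
  Num.sqrt (1 + \sum_i u 0 i ^+ 2) * Num.sqrt (1 + \sum_i v 0 i ^+ 2).
Proof. exact: graph_lorentz. Qed.

Lemma chart_inj : injective chart.
Proof.
by move=> u v [/rowP uv]; apply/rowP => i; have := uv (lift ord0 i); rewrite !graphS.
Qed.

Lemma chart_surj x : exists2 u, chart u = x &
  forall i, u 0 i = hpoint x 0 (lift ord0 i).
Proof.
have /andP[/eqP xx x0] := hpointP x.
exists (\row_i hpoint x 0 (lift ord0 i)) => [|i]; last by rewrite mxE.
apply: val_inj; apply/rowP => j; case: (unliftP ord0 j) => [i ->|->] /=.
  by rewrite graphS mxE.
rewrite graph0; under eq_bigr do rewrite mxE expr2.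
move: xx; rewrite /lorentz => /eqP; rewrite subr_eq => /eqP ->.
by rewrite addrA subrr add0r -expr2 sqrtr_sqr gtr0_norm.
Qed.

Lemma chart_continuous : continuous chart.
Proof.
move=> u; apply/(@metricType_numDomainType.cvgrPdist_lt _ _ _ (nbhs u) _) => e e0.
pose B v := Num.sqrt (1 + \sum_i u 0 i ^+ 2) *
  Num.sqrt (1 + \sum_i v 0 i * v 0 i) - \sum_i u 0 i * v 0 i.
have BE v : cosh (mdist (chart u) (chart v)) = B v.
  rewrite cosh_mdist chart_lorentz opprB /B; congr (_ * Num.sqrt (1 + _) - _).
have cB : {for u, continuous B}.
  have coord i v : {for v, continuous (fun v : 'rV[R]_n => v 0 i)}.
    exact: coord_continuous.
  have sum (f : 'I_n -> 'rV[R]_n -> R) :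
      (forall i, continuous (f i)) -> continuous (fun v => \sum_i f i v).
    by move=> cf; apply: continuous_big => [|i _]; [exact: add_continuous|exact: cf].
  apply: continuousB; last first.
    apply: sum => i v; apply: continuousM; [exact: cst_continuous|exact: coord].
  apply: continuousM; first exact: cst_continuous.
  apply: (@continuous_comp _ _ _ _ Num.sqrt); last exact: sqrt_continuous.
  apply: continuousD; first exact: cst_continuous.
  by apply: sum => i v; apply: continuousM; exact: coord.
have c : B @ u --> B u by exact: cB.
rewrite -BE mdistxx cosh0 in c.
have ce : 1 < cosh e by rewrite -cosh0 ltr_cosh.
near=> v.
rewrite ltNge; apply/negP => ve.
have : cosh e <= cosh (mdist (chart u) (chart v)).
  by rewrite ler_cosh// gtr0_norm.
rewrite BE leNgt => /negP; apply.
by near: v; exact: cvgr_lt c _ ce.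
Unshelve. all: by end_near. Qed.

(** Enough of the properness of H^n to use proper discontinuity: the compact set
    is the image of a box under [chart]. *)
Lemma bounded_sub_compact x C :
  exists2 K : set (hyperbolic R n), compact K & forall y, mdist x y <= C -> K y.
Proof.
pose o := chart 0; pose B := cosh (mdist o x + C).
exists (chart @` [set u : 'rV[R]_n | forall i, `[- B, B]%classic (u 0 i)]).
  apply: continuous_compact.
    by apply: continuous_subspaceT; exact: chart_continuous.
  apply: (@rV_compact R n (fun=> `[- B, B]%classic)) => i.
  exact: segment_compact.
move=> y xy; have [u uy uE] := chart_surj y; exists u => //= i.
have /andP[/eqP yy y0] := hpointP y.
have B0 : 0 < B by rewrite (lt_le_trans ltr01)// cosh_ge1.
have oy : hpoint y 0 0 = cosh (mdist o y).
  rewrite cosh_mdist -uy chart_lorentz opprB [X in _ - X]big1 => [|j _]; last first.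
    by rewrite mxE mul0r.
  rewrite [X in _ = Num.sqrt (1 + X) * _ - _]big1 => [|j _]; last first.
    by rewrite mxE expr0n.
  by rewrite addr0 sqrtr1 mul1r subr0; exact: graph0.
have yB : hpoint y 0 0 <= B.
  rewrite oy; apply: ler_cosh; rewrite ger0_norm ?mdist_ge0//.
  by apply: le_trans (metric_triangle _ x _) _; rewrite lerD2l.
rewrite in_itv /= -ler_norml -(@ler_pXn2r _ 2) ?nnegrE ?(ltW B0)//.
rewrite real_normK ?num_real//.
apply: le_trans (_ : _ <= hpoint y 0 0 ^+ 2) _; last first.
  by rewrite ler_pXn2r// nnegrE ltW.
rewrite uE; move: yy; rewrite /lorentz (bigD1 i)//= => /eqP; rewrite subr_eq => /eqP.
rewrite -!expr2 => yy.
have : 0 <= \sum_(j < n | j != i)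
    hpoint y 0 (lift ord0 j) * hpoint y 0 (lift ord0 j).
  by apply: sumr_ge0 => j _; rewrite -expr2 sqr_ge0.
by lra.
Qed.

End CompactnessInHyperbolicSpace.

Lemma two_points {R : realType} {n : nat} : (0 < n)%N ->
  exists x y : hyperbolic R n, x != y.
Proof.
case: n => // n _; exists (chart 0), (chart (const_mx 1)).
apply/eqP => /chart_inj /rowP /(_ ord0); rewrite !mxE => /eqP.
by rewrite eq_sym oner_eq0.
Qed.

Lemma finite_set_min {R : realType} (A : set R) : finite_set A -> A !=set0 ->
  exists2 a, A a & forall b, A b -> a <= b.
Proof.
move=> /finite_seqP[s ->]; elim: s => [|a s IHs] [x xs]; first by [].
have [[m /= ms mP]|s0] := pselect (exists2 a, a \in s & forall b, b \in s -> a <= b).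
  exists (Num.min a m) => /= [|b].
    by rewrite inE; case: leP => _; rewrite ?eqxx ?ms ?orbT.
  by rewrite inE => /predU1P[->|/mP]; rewrite ge_min ?lexx// => ->; rewrite orbT.
exists a => /= [|b]; first by rewrite mem_head.
rewrite inE => /predU1P[->//|bs]; exfalso; apply: s0.
by apply: IHs; exists b.
Qed.

Lemma mdist_continuous {R : realType} (X Y : metricType R) (f g : X -> Y) :
  (forall x y, mdist (f x) (f y) <= mdist x y) ->
  (forall x y, mdist (g x) (g y) <= mdist x y) ->
  continuous (fun x => mdist (f x) (g x) : R).
Proof.
move=> f1 g1 x; apply/cvgrPdist_lt => e e0.
have : \forall y \near x, ball x (e / 2) y.
  by apply: nbhsx_ballx; rewrite divr_gt0.
apply: filterS => y; rewrite ballEmdist /= => xy.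
have := f1 x y; have := g1 x y.
have := metric_triangle (f x) (f y) (g x).
have := metric_triangle (f y) (g y) (g x).
have := metric_triangle (f y) (f x) (g y).
have := metric_triangle (f x) (g x) (g y).
rewrite (metric_sym (g y) (g x)) (metric_sym (f y) (f x)).
by rewrite ltr_norml; lra.
Qed.

(** * The geometry of a compact hyperbolic manifold *)

Section HyperbolicManifold.
Context {R : realType} {n : nat} (M : metricType R)
  (G : set (hyperbolic R n -> hyperbolic R n)) (p : hyperbolic R n -> M).
Implicit Types x y z : hyperbolic R n.
Context (isoG : isometry_group G) (freeG : acts_freely G)
  (discG : acts_properly_discontinuously G) (compactM : compact [set: M])
  (p_surj : forall m, exists x, p x = m)
  (p_orbit : forall x y, p x = p y <-> exists2 g, G g & y = g x)
  (p_mdist : forall x y, mdist (p x) (p y) = inf [set mdist x (g y) | g in G]).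

(** Only finitely many points of the orbit of y are at least as close to x as
    y. *)
Lemma orbit_mdist_attained x y :
  exists2 g, G g & mdist x (g y) = mdist (p x) (p y).
Proof.
have [G1 _ _ _] := isoG.
have [K cK BK] := bounded_sub_compact x (mdist x y).
pose D := [set mdist x (g y) | g in G].
pose A := [set mdist x (g y) | g in
  [set g | G g /\ (g @` K) `&` K !=set0]].
have AD : A `<=` D by move=> _ [g [Gg _] <-]; exists g.
have AG g : G g -> mdist x (g y) <= mdist x y -> A (mdist x (g y)).
  move=> Gg gy; exists g => //; split => //; exists (g y); split; last exact: BK.
  by exists y => //; exact: BK.
have [||_ [g [Gg _] <-] gmin] := @finite_set_min _ A.
- exact/finite_image/discG.
- by exists (mdist x y); exact: (AG id).
exists g => //; rewrite p_mdist -/D; apply/eqP; rewrite eq_le; apply/andP; split.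
  apply: lb_le_inf; first by exists (mdist x y), id.
  move=> _ [h Gh <-]; have [hy|/ltW hy] := leP (mdist x (h y)) (mdist x y).
    exact/gmin/AG.
  by apply: le_trans hy; apply: gmin; exact: (AG id).
by apply: ge_inf; [exists 0 => _ [h _ <-]; exact: mdist_ge0|exists g].
Qed.

Lemma projection_lipschitz x y : mdist (p x) (p y) <= mdist x y.
Proof.
have [G1 _ _ _] := isoG.
rewrite p_mdist; apply: ge_inf; last by exists id.
by exists 0 => _ [h _ <-]; exact: mdist_ge0.
Qed.

Lemma lift_point x m : exists2 y, p y = m & mdist x y = mdist (p x) m.
Proof.
have [y <-] := p_surj m; have [g Gg xg] := orbit_mdist_attained x y.
by exists (g y) => //; apply/esym/p_orbit; exists g.
Qed.

Lemma manifold_bounded : exists2 D, 0 < D & forall m m' : M, mdist m m' <= D.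
Proof.
have [[m0]|M0] := pselect (exists m : M, True); last first.
  by exists 1 => // m m'; case: M0; exists m.
have c : continuous (fun m => mdist m0 m : R).
  by apply: (mdist_continuous (f := fun=> m0)) => // x y; rewrite mdistxx mdist_ge0.
have [|m1 _ m1P] := compact_EVT_max _ compactM (continuous_subspaceT c).
  by exists m0.
exists (mdist m0 m1 + mdist m0 m1 + 1) => [|m m'].
  by rewrite ltr_wpDl ?addr_ge0 ?mdist_ge0.
have := m1P m (in_setT _); have := m1P m' (in_setT _).
by have := metric_triangle m m0 m'; rewrite (metric_sym m m0); lra.
Qed.

Lemma geodesic_manifold (m m' : M) t : 0 <= t ->
  exists2 m'', mdist m m'' <= t & mdist m'' m' <= Num.max 0 (mdist m m' - t).
Proof.
move=> t0; have [tm|mt] := leP (mdist m m') t.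
  by exists m' => //; rewrite mdistxx le_max lexx.
have [x px] := p_surj m; have [y py] := lift_point x m'; rewrite px => xy.
have xNy : x != y by rewrite -mdist_gt0 xy (le_lt_trans t0).
have [z xz zy] := geodesic_point xNy t0; exists (p z).
  by rewrite -px -xz projection_lipschitz.
rewrite -py (le_trans (projection_lipschitz _ _))// zy xy ger0_norm//.
  by rewrite le_max py lexx orbT.
by rewrite subr_ge0 ltW.
Qed.

(** Conjugation brings x into a fixed bounded set, where only finitely many g
    move some point by less than 1.  Each of these, being without fixed points,
    moves the points of a compact set by at least a positive constant. *)
Lemma injectivity_radius :
  exists2 e, 0 < e & forall x g, G g -> mdist x (g x) < e -> g = id.
Proof.
have [_ GM GV Giso] := isoG.
have [D D0 DP] := manifold_bounded.
have [x0 _] := p_surj (p (chart 0)).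
have [K cK BK] := bounded_sub_compact x0 (D + 1).
pose F := [set g | G g /\ (g @` K) `&` K !=set0].
have r_exists g : exists r : R, 0 < r /\
    (G g -> g <> id -> forall x, K x -> r <= mdist x (g x)).
  have [[Gg gN]|gP] := pselect (G g /\ g <> id); last first.
    by exists 1; split => // Gg gN; case: gP.
  have c : continuous (fun x => mdist x (g x) : R).
    by apply: (mdist_continuous (f := id)) => // x y; rewrite Giso.
  have [|m /set_mem Km mP] := compact_EVT_min _ cK (continuous_subspaceT c).
    by exists x0; apply: BK; rewrite mdistxx addr_ge0// ltW.
  exists (mdist m (g m)); split => [|_ _ x /mem_set]; last exact: mP.
  by rewrite mdist_gt0; apply/eqP => /esym gm; apply: gN; exact: (freeG Gg gm).
have [r rP] := choice r_exists.
have [||e Se emin] := @finite_set_min _ (1 |` (r @` F)).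
- by rewrite finite_setU; split; [exact: finite_set1|exact/finite_image/discG].
- by exists 1; left.
have e1 : e <= 1 by apply: emin; left.
exists e => [|x g Gg xg].
  by case: Se => [->|[g _ <-]]; [exact: ltr01|have [] := rP g].
have [y /esym/p_orbit[h Gh yE] x0y] := lift_point x0 (p x).
have [h' Gh' [hK h'K]] := GV _ Gh.
pose f := h \o (g \o h'); have Gf : G f by exact: GM Gh (GM _ _ Gg Gh').
have yf : mdist y (f y) = mdist x (g x) by rewrite yE /f /= hK Giso.
have fid : f = id.
  apply: contrapT => fN; have [_ /(_ Gf fN y) rf] := rP f.
  have Ky : K y by apply: BK; have := DP (p x0) (p x); lra.
  have Kfy : K (f y).
    apply: BK; have := DP (p x0) (p x); have := metric_triangle x0 y (f y); lra.
  have : e <= r f.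
    by apply: emin; right; exists f => //; split => //; exists (f y); split => //; exists y.
  by have := rf Ky; lra.
apply/funext => z /=; have /(congr1 (fun f => h' (f (h z)))) := fid.
by rewrite /f /= !hK.
Qed.

(** Below half the injectivity radius, a translate of y that is closest to x can
    only be y. *)
Lemma projection_isometric : exists2 e, 0 < e &
  forall x y, mdist x y < e -> mdist (p x) (p y) = mdist x y.
Proof.
have [e e0 eP] := injectivity_radius; exists (e / 2) => [|x y xy].
  by rewrite divr_gt0.
have [g Gg xg] := orbit_mdist_attained x y.
have := projection_lipschitz x y; rewrite -xg => gy.
rewrite (eP y g Gg)//.
by have := metric_triangle y x (g y); rewrite (metric_sym y x); lra.
Qed.

(** The scale e is small enough that the geodesic from the pursuer through the
    robber, prolonged by e, still minimizes distances in M. *)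
Lemma escape_single_pursuer : (0 < n)%N -> exists2 e, 0 < e &
  (exists c r : M, e <= mdist c r) /\
  forall c r : M, e <= mdist c r ->
    exists2 r', mdist r r' <= e & 2 * e <= mdist c r'.
Proof.
move=> n0; have [e e0 eP] := projection_isometric.
have e4 : 0 < e / 4 by rewrite divr_gt0.
exists (e / 4) => //; split.
  have [x [y xy]] := @two_points R n n0.
  have [z xz _] := geodesic_point xy (ltW e4).
  by exists (p x), (p z); rewrite eP xz//; lra.
move=> c r cr; have [far|near] := leP (2 * (e / 4)) (mdist c r).
  by exists r => //; rewrite mdistxx ltW.
have [x px] := p_surj c; have [y py] := lift_point x r; rewrite px => xy.
have xNy : x != y by rewrite -mdist_gt0 xy (lt_le_trans e4).
have [|z xz zy] := @geodesic_point _ _ _ _ (mdist x y + e / 4) xNy.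
  by rewrite addr_ge0 ?mdist_ge0// ltW.
exists (p z).
  rewrite -py (le_trans (projection_lipschitz _ _))// (metric_sym y) zy.
  by rewrite opprD addrA subrr add0r normrN gtr0_norm.
by rewrite -px eP; lra.
Qed.

End HyperbolicManifold.

(** * Winning and losing strategies *)

Section WinningPlays.
Context {R : realType} (X : metricType R) (k : nat).
Context (p0 : position X k) (sigma : cop_strategy X k)
  (rho : robber_strategy X k).

Let gap n i := mdist ((position_after p0 sigma rho n).2 i)
                     (position_after p0 sigma rho n).1.

Lemma cops_win_play_close :
  (forall e, 0 < e -> exists n i, gap n i < e) -> cops_win_play p0 sigma rho.
Proof.
move=> close; apply/eqP; rewrite eq_le; apply/andP; split.
  apply/lee_addgt0Pr => e e0; rewrite add0e; have [n [i ni]] := close e e0.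
  by apply: ge_ereal_inf; exists (gap n i)%:E; [exists (n, i)|rewrite lee_fin ltW].
by apply: le_ereal_inf_tmp => _ [ni _ <-]; rewrite lee_fin mdist_ge0.
Qed.

Lemma cops_lose_play e : 0 < e -> (forall n i, e <= gap n i) ->
  ~ cops_win_play p0 sigma rho.
Proof.
move=> e0 far win.
suff : (e%:E <= 0%:E)%E by rewrite lee_fin leNgt e0.
rewrite -[X in (_ <= X)%E]win; apply: le_ereal_inf_tmp => _ [ni _ <-].
by rewrite lee_fin far.
Qed.

End WinningPlays.

Section StatefulStrategies.
Context {R : realType} (X : metricType R) (k : nat) (tau : nat -> R).
Context (S : Type) (pos : S -> position X k) (inv : S -> Prop)
  (step : nat -> S -> S -> Prop) (s0 : S).

(** The cops may keep a private state: they recompute it from the history, by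
    folding the past moves of the robber.  Histories that do not come from a
    play following the strategy can make the computed move illegal, in which
    case a cop stays where it is. *)
Lemma stateful_strategy : (forall n, 0 <= tau n) -> inv s0 ->
  (forall n s r, inv s -> mdist (pos s).1 r <= tau n ->
    exists s', [/\ inv s', step n s s', (pos s').1 = r &
      forall i, mdist ((pos s).2 i) ((pos s').2 i) <= tau n]) ->
  exists2 sigma : cop_strategy X k, legal_cops tau sigma &
    forall rho : robber_strategy X k, legal_robber tau rho ->
      exists s : nat -> S, [/\ s 0 = s0, forall n, inv (s n),
        forall n, step n.+1 (s n) (s n.+1) &
        forall n, position_after (pos s0) sigma rho n = pos (s n)].
Proof.
move=> tau_ge0 inv0 steps.
have /choice[next nextP] : forall x : nat * S * X, exists s',
    inv x.1.2 -> mdist (pos x.1.2).1 x.2 <= tau x.1.1 ->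
    [/\ inv s', step x.1.1 x.1.2 s', (pos s').1 = x.2 &
      forall i, mdist ((pos x.1.2).2 i) ((pos s').2 i) <= tau x.1.1].
  move=> [[n s] r] /=.
  have [[I sr]|IN] := pselect (inv s /\ mdist (pos s).1 r <= tau n).
    by have [s' s'P] := steps n s r I sr; exists s'.
  by exists s0 => I sr; case: IN.
pose state := fix state (h : seq (position X k)) : S :=
  if h is p :: h' then
    if h' is [::] then s0 else next (size h', state h', p.1)
  else s0.
pose sigma : cop_strategy X k := fun h r i =>
  if h is p :: _ then
    let x := (pos (next (size h, state h, r))).2 i in
    if mdist (p.2 i) x <= tau (size h) then x else p.2 i
  else (pos s0).2 i.
exists sigma => [p h r i|rho legal_rho].
  by rewrite /sigma; case: ifP => // _; rewrite mdistxx.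
pose h n := history (pos s0) sigma rho n.
have hE n : exists h', h n = position_after (pos s0) sigma rho n :: h' /\
    size h' = n.
  elim: n => [|n [h' [hn sh']]]; first by exists [::].
  by exists (h n); split => //; rewrite hn /= sh'.
have sh n : size (h n) = n.+1 by have [h' [-> <-]] := hE n.
have play n : inv (state (h n)) ->
    position_after (pos s0) sigma rho n = pos (state (h n)) ->
    [/\ inv (state (h n.+1)), step n.+1 (state (h n)) (state (h n.+1)) &
      position_after (pos s0) sigma rho n.+1 = pos (state (h n.+1))].
  move=> In pn; have [h' [hn sh']] := hE n.
  have legal : mdist (pos (state (h n))).1 (rho (h n)) <= tau n.+1.
    by rewrite -pn hn -sh'; exact: legal_rho.
  have -> : state (h n.+1) = next (n.+1, state (h n), rho (h n)).
    rewrite -[h n.+1]/((rho (h n), sigma (h n) (rho (h n))) :: h n).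
    by rewrite -(sh n) hn.
  have [I' s' r' c'] := nextP (n.+1, state (h n), rho (h n)) In legal.
  split => //.
  have -> : position_after (pos s0) sigma rho n.+1 =
      (rho (h n), sigma (h n) (rho (h n))) by [].
  rewrite [RHS]surjective_pairing r'; congr pair; apply/funext => i.
  rewrite /sigma {1 2}hn -{1}hn sh /=.
  by have := c' i; rewrite -pn => ->.
have main n : inv (state (h n)) /\
    position_after (pos s0) sigma rho n = pos (state (h n)).
  by elim: n => [//|n [In pn]]; have [] := play n In pn.
exists (fun n => state (h n)); split => // n; [exact: (main n).1| |exact: (main n).2].
by have [In pn] := main n; have [] := play n In pn.
Qed.

End StatefulStrategies.

Lemma constant_agility {R : realType} (e : R) : 0 < e -> agility (fun=> e).
Proof.
move=> e0; split => [n|]; first exact: ltW.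
have -> : (fun n => \sum_(1 <= i < n.+1) e) = (fun n => n%:R * e).
  by apply/funext => n; rewrite sumr_const_nat subn1 mulr_natl.
apply/cvgryPge => A; near=> n; rewrite -ler_pdivrMr//.
by near: n; exact: nbhs_infty_ger.
Unshelve. all: by end_near. Qed.

(** The infimum over the empty family of distances is infinite. *)
Lemma no_cop_cannot_win {R : realType} (M : metricType R) (m : M) :
  ~ cops_can_win M 0.
Proof.
move=> /(_ _ (m, fun=> m) (constant_agility ltr01))[sigma _ win].
pose rho (h : seq (position M 0)) := (head (m, fun=> m) h).1.
suff /win : legal_robber (fun=> 1) rho.
  by apply: (cops_lose_play ltr01) => n [].
by move=> p h; rewrite /rho /= mdistxx.
Qed.

(** Whatever the cop does, at the end of each round its distance to the robber
    is at least 2e - e. *)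
Lemma one_cop_cannot_win {R : realType} (M : metricType R) (e : R) : 0 < e ->
  (exists c r : M, e <= mdist c r) ->
  (forall c r : M, e <= mdist c r ->
    exists2 r', mdist r r' <= e & 2 * e <= mdist c r') ->
  ~ cops_can_win M 1.
Proof.
move=> e0 [c0 [r0 cr0]] escape.
move=> /(_ _ (r0, fun=> c0) (constant_agility e0))[sigma legal win].
have /choice[f fP] : forall x : M * M, exists r', mdist x.2 r' <= e /\
    (e <= mdist x.1 x.2 -> 2 * e <= mdist x.1 r').
  move=> [c r] /=.
  have [/escape[r' rr' cr']|_] := leP e (mdist c r); first by exists r'.
  by exists r; rewrite mdistxx ltW.
pose rho (h : seq (position M 1)) :=
  let p := head (r0, fun=> c0) h in f (p.2 ord0, p.1).
suff /win : legal_robber (fun=> e) rho.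
  apply: (cops_lose_play e0) => n i; rewrite (ord1 i) {i}.
  elim: n => [//|n IHn].
  rewrite /position_after /=.
  set h := history _ _ _ _ in IHn *.
  have [p [h' hE]] : exists p h', h = p :: h'.
    by rewrite /h; case: (n) => [|?] /=; eexists; eexists.
  rewrite /position_after -/h hE /= in IHn.
  have [_ /(_ IHn) far] := fP (p.2 ord0, p.1).
  have := legal p h' (rho h) ord0; rewrite hE /=.
  have := metric_triangle (p.2 ord0) (sigma (p :: h') (rho (p :: h')) ord0)
    (rho (p :: h')).
  move: far; rewrite /rho /=; lra.
by move=> p h; rewrite /rho /=; exact: (fP (_, _)).1.
Qed.

(** * The pursuit by two cops *)

Section Pursuit.
Context {R : realType} {n : nat} (M : metricType R) (p : hyperbolic R n -> M).
Context (p_lipschitz : forall x y, mdist (p x) (p y) <= mdist x y)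
  (p_lift : forall x m, exists2 y, p y = m & mdist x y = mdist (p x) m)
  (M_geodesic : forall (m m' : M) t, 0 <= t ->
    exists2 m'', mdist m m'' <= t & mdist m'' m' <= Num.max 0 (mdist m m' - t)).
Context (D : R) (D_gt0 : 0 < D) (M_bounded : forall m m' : M, mdist m m' <= D).

(** The robber and the chaser live upstairs.  The ambusher lives in M because
    its only data are shortest paths in M towards projected points; the clock is
    the agility spent since the start of the current phase. *)
Record pursuit := Pursuit {
  robber : hyperbolic R n ;
  chaser : hyperbolic R n ;
  ambusher : M ;
  target : hyperbolic R n ;
  clock : R }.

Section Strategy.
Context (tau : nat -> R) (tau_agility : agility tau).
Context (o : hyperbolic R n).

Let tau_ge0 i : 0 <= tau i. Proof. exact: tau_agility.1. Qed.

Definition positions s : position M 2 :=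
  (p (robber s), fun i => if i == ord0 then p (chaser s) else ambusher s).

Definition on_radius s : Prop :=
  mdist o (robber s) = mdist o (chaser s) + mdist (chaser s) (robber s).

Definition expires i s : bool := 2 * D < clock s + tau i.

(** The chaser makes a [lion_step].  The ambusher goes to the target, except in
    the last round of a phase: then it goes to the robber and the next target is
    chosen, which requires that the robber be off o. *)
Definition pursuit_step i s s' : Prop :=
  [/\ mdist (robber s) (robber s') <= tau i,
      mdist (chaser s') (robber s') <= Num.max 0 (mdist (chaser s) (robber s) -
        (1 - expR (- mdist (chaser s) (robber s))) *
        (tau i - (mdist o (robber s') - mdist o (robber s)))) &
      if expires i s then
        [/\ mdist (ambusher s') (p (robber s')) <=
              Num.max 0 (mdist (ambusher s) (p (robber s')) - tau i),
            clock s' = 0 &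
            o != robber s' -> mdist (robber s') (target s') = 2 * D /\
              mdist o (target s') = mdist o (robber s') + 2 * D]
      else
        [/\ mdist (ambusher s') (p (target s)) <=
              Num.max 0 (mdist (ambusher s) (p (target s)) - tau i),
            clock s' = clock s + tau i & target s' = target s]].

Lemma pursuit_step_exists i s r : on_radius s ->
  mdist (positions s).1 r <= tau i ->
  exists s', [/\ on_radius s', pursuit_step i s s', (positions s').1 = r &
    forall j, mdist ((positions s).2 j) ((positions s').2 j) <= tau i].
Proof.
rewrite /positions /= => rad sr; have [r' pr' rr'] := p_lift (robber s) r.
move: sr; rewrite -rr' => sr; have [c' [rad' cc' cr']] := lion_step rad sr.
have D2 : 0 <= 2 * D by rewrite mulr_ge0// ltW.
have [q qP] : exists q, o != r' -> mdist r' q = 2 * D /\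
    mdist o q = mdist o r' + 2 * D.
  have [->|or'] := eqVneq o r'; first by exists o.
  have [|q oq qr] := @geodesic_point _ _ _ _ (mdist o r' + 2 * D) or'.
    by rewrite addr_ge0// mdist_ge0.
  exists q => _; split => //.
  by rewrite metric_sym qr opprD addrA subrr add0r normrN ger0_norm.
have [ex|nex] := boolP (expires i s).
  have [a' aa' ar'] := M_geodesic (ambusher s) (p r') (tau_ge0 i).
  exists (Pursuit r' c' a' q 0); rewrite /pursuit_step ex; split=> [||//|j /=].
  - exact: rad'.
  - by split.
  by case: ifP => // _; exact: le_trans (p_lipschitz _ _) cc'.
have [a' aa' at'] := M_geodesic (ambusher s) (p (target s)) (tau_ge0 i).
exists (Pursuit r' c' a' (target s) (clock s + tau i)).
rewrite /pursuit_step (negbTE nex); split=> [||//|j /=].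
- exact: rad'.
- by split.
by case: ifP => // _; exact: le_trans (p_lipschitz _ _) cc'.
Qed.

Section InfinitePursuit.
Context (s : nat -> pursuit) (clock0 : clock (s 0) = 0)
  (s_radius : forall i, on_radius (s i))
  (s_step : forall i, pursuit_step i.+1 (s i) (s i.+1)).

Let r i := robber (s i).
Let c i := chaser (s i).
Let a i := ambusher (s i).
Let t i : R := \sum_(1 <= j < i.+1) tau j.
(* What the robber loses against running straight away from o. *)
Let loss i : R := t i - mdist o (r i).

Let tS i : t i.+1 = t i + tau i.+1.
Proof. by rewrite /t big_nat_recr. Qed.

Let t_le i j : (i <= j)%N -> t i <= t j.
Proof.
move=> /subnK <-; elim: (j - i)%N => [//|k IHk].
by rewrite addSn tS (le_trans IHk)// lerDl.
Qed.

Let t_unbounded A : exists i, A < t i.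
Proof.
have [_ /cvgryPgt /(_ A)] := tau_agility.
by case=> i _ /(_ i (leqnn i)); exists i.
Qed.

Let r_dist i j : (i <= j)%N -> mdist (r i) (r j) <= t j - t i.
Proof.
move=> /subnK <-; elim: (j - i)%N => [|k IHk]; first by rewrite mdistxx subrr.
rewrite addSn tS; have [rr _ _] := s_step (k + i).
by have := metric_triangle (r i) (r (k + i)) (r (k + i).+1); rewrite /r in rr IHk *; lra.
Qed.

Let clock_itv i : 0 <= clock (s i) <= 2 * D.
Proof.
elim: i => [|i IHi]; first by rewrite clock0 lexx mulr_ge0// ltW.
have [_ _] := s_step i; rewrite /expires; case: ltP => [_ [_ -> _]|le [_ -> _]].
  by rewrite lexx mulr_ge0// ltW.
by rewrite le andbT addr_ge0//; have /andP[] := IHi.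
Qed.

(* Phases end because the total agility is infinite. *)
Let expires_after N : exists2 i, (N <= i)%N & expires i.+1 (s i).
Proof.
apply: contrapT => noexp.
have clockE k : clock (s (N + k)) = clock (s N) + (t (N + k) - t N).
  elim: k => [|k IHk]; first by rewrite addn0 subrr addr0.
  have [_ _] := s_step (N + k); rewrite addnS; case: ifPn => [ex|_ [_ -> _]].
    by case: noexp; exists (N + k)%N => //; exact: leq_addr.
  by rewrite IHk tS; lra.
have [i ti] := t_unbounded (2 * D + t N).
have Ni : (N <= i)%N.
  rewrite leqNgt; apply/negP => /ltnW /t_le; rewrite leNgt => /negP; apply.
  by rewrite (le_lt_trans _ ti)// lerDr mulr_ge0// ltW.
have := clockE (i - N)%N; rewrite subnKC//.
have /andP[_] := clock_itv i; have /andP[] := clock_itv N; lra.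
Qed.

Let next_expires N : exists k, expires (N + k).+1 (s (N + k)) /\
  forall j, (j < k)%N -> ~~ expires (N + j).+1 (s (N + j)).
Proof.
have ex : exists k, expires (N + k).+1 (s (N + k)).
  by have [i Ni ei] := expires_after N; exists (i - N)%N; rewrite subnKC.
exists (ex_minn ex); case: ex_minnP => k ek kmin; split => // j jk.
by apply/negP => /kmin; rewrite leqNgt jk.
Qed.

(* Throughout a phase that starts in round N the ambusher spends its agility on
   approaching the projection of the target, which is at distance at most D. *)
Let ambush N k : (forall j, (j < k)%N -> ~~ expires (N + j).+1 (s (N + j))) ->
  clock (s N) = 0 -> [/\ clock (s (N + k)) = t (N + k) - t N,
    target (s (N + k)) = target (s N) &
    mdist (a (N + k)) (p (target (s N))) <= Num.max 0 (D - clock (s (N + k)))].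
Proof.
move=> + cN; elim: k => [_|k IHk nex].
  by rewrite addn0 cN !subrr subr0; split => //; rewrite le_max M_bounded orbT.
have [j jk|cE tE aE] := IHk; first by apply: nex; exact: ltnW.
have [_ _] := s_step (N + k); rewrite (negbTE (nex k (ltnSn k))) tE cE addnS.
move=> [a' -> ->]; rewrite tS; split; [by lra|by []|].
have tk := tau_ge0 (N + k).+1.
move: a' aE; rewrite cE /a !le_max => /orP[->//|a'] /orP[a0|aD]; apply/orP.
  by left; lra.
by right; lra.
Qed.

(** A chaser kept at distance delta makes the total loss bounded.  After the
    round N where the loss is within eta of its supremum, consider a complete
    phase, from round i0 + 1 to round i0 + 1 + m.  The ambusher sits on the
    target when the phase expires: since it fails to reach the robber in the
    expiring round, the agility of that round is at most D, and the other rounds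
    of the phase provided at least D.  The robber overtakes the target by less
    than that last agility, up to delta / 2, so the ambusher ends at distance
    at most delta / 2 from it. *)
Lemma pursuit_succeeds (delta : R) : 0 < delta ->
  ~ (forall i, delta <= mdist (p (c i)) (p (r i)) /\
               delta <= mdist (a i) (p (r i))).
Proof.
move=> d0 far.
have cr i : delta <= mdist (c i) (r i).
  by apply: le_trans (p_lipschitz _ _); exact: (far i).1.
have Or i : delta <= mdist o (r i).
  by rewrite (s_radius i) (le_trans (cr i))// lerDr mdist_ge0.
pose k := 1 - expR (- delta).
have k0 : 0 < k by rewrite subr_gt0 -[ltRHS]expR0 ltr_expR; lra.
have lossS i : 0 <= loss i.+1 - loss i.
  have [rr _ _] := s_step i.
  by have := metric_triangle o (r i) (r i.+1); rewrite /loss tS /r in rr *; lra.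
have loss_le i j : (i <= j)%N -> loss i <= loss j.
  move=> /subnK <-; elim: (j - i)%N => [//|m IHm].
  by rewrite addSn (le_trans IHm)// -subr_ge0.
have drop i : mdist (c i.+1) (r i.+1) + k * loss i.+1 <=
    mdist (c i) (r i) + k * loss i.
  have [_ + _] := s_step i; rewrite -/(c i) -/(r i) -/(r i.+1) -/(c i.+1).
  have -> : tau i.+1 - (mdist o (r i.+1) - mdist o (r i)) = loss i.+1 - loss i.
    by rewrite /loss tS; ring.
  rewrite le_max => /orP[|h]; first by have := cr i.+1; lra.
  have : k * (loss i.+1 - loss i) <=
      (1 - expR (- mdist (c i) (r i))) * (loss i.+1 - loss i).
    by rewrite ler_wpM2r// lerD2l lerN2 ler_expR lerN2.
  lra.
have drop0 i : mdist (c i) (r i) + k * loss i <= mdist (c 0) (r 0) + k * loss 0.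
  by elim: i => [//|i IHi]; exact: le_trans (drop i) IHi.
have loss_bounded : has_sup (range loss).
  split; first by exists (loss 0), 0.
  exists ((mdist (c 0) (r 0) + k * loss 0) / k) => _ [i _ <-].
  by rewrite ler_pdivlMr// mulrC; have := drop0 i; have := mdist_ge0 (c i) (r i); lra.
have dd0 : 0 < delta / 2 by rewrite divr_gt0.
have D2 : 0 < 2 * D by rewrite mulr_gt0.
have [eta eta0 overtaking] := @overtake R n delta (2 * D) (delta / 2) d0 D2 dd0.
have [_ [N _ <-] lossN] := sup_adherent eta0 loss_bounded.
have loss_tail i j : (N <= i)%N -> loss j - loss i <= eta.
  move=> /loss_le Ni; have : loss j <= sup (range loss).
    by apply: sup_upper_bound => //; exists j.
  lra.
have ambusher_at_expiry i : expires i.+1 (s i) ->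
    mdist (a i) (p (r i.+1)) - tau i.+1 >= delta.
  move=> ex; have [_ _] := s_step i; rewrite ex => -[h _ _].
  move: (far i.+1).2 h; rewrite -/(a i) -/(a i.+1) -/(r i.+1).
  by move=> ? /(le_trans _) => /(_ _ (far i.+1).2); rewrite le_max leNgt d0.
have tauD i : expires i.+1 (s i) -> tau i.+1 <= D.
  by move=> /ambusher_at_expiry; have := M_bounded (a i) (p (r i.+1)); lra.
(* The rounds before N may have left a bad target, so the first expiry after N
   only serves to start a fresh phase. *)
have [i0 Ni0 ex0] := expires_after N.
have [_ _] := s_step i0; rewrite ex0 => -[_ clk0].
have oNr : o != r i0.+1 by rewrite -mdist_gt0 (lt_le_trans d0).
move=> /(_ oNr) [rq oq].
have [m [exm nex]] := next_expires i0.+1.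
have [cE tE aE] := ambush nex clk0.
have := ambusher_at_expiry _ exm; have tD := tauD _ exm.
have /andP[_ cD] := clock_itv (i0.+1 + m).
have ex' : 2 * D < clock (s (i0.+1 + m)) + tau (i0.+1 + m).+1 by exact: exm.
have aq : mdist (a (i0.+1 + m)) (p (target (s i0.+1))) <= 0.
  by move: aE; rewrite le_max => /orP[//|]; lra.
have i0m : (i0.+1 <= (i0.+1 + m).+1)%N by rewrite leqW// leq_addr.
have rr := r_dist i0m.
have ls := loss_tail i0.+1 (i0.+1 + m).+1 (leqW Ni0).
have tE' : t (i0.+1 + m).+1 - t i0.+1 =
    clock (s (i0.+1 + m)) + tau (i0.+1 + m).+1 by rewrite tS cE; ring.
have := overtaking o (r i0.+1) (target (s i0.+1)) (r (i0.+1 + m).+1)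
  (t (i0.+1 + m).+1 - t i0.+1) (Or _) rq oq _ rr.
have -> : (2 * D <= t (i0.+1 + m).+1 - t i0.+1 <= 2 * (2 * D)).
  by rewrite tE'; lra.
move=> /(_ isT); have -> : mdist o (r i0.+1) + (t (i0.+1 + m).+1 - t i0.+1) - eta <=
    mdist o (r (i0.+1 + m).+1) by move: ls; rewrite /loss; lra.
move=> /(_ isT) qr.
have := p_lipschitz (target (s i0.+1)) (r (i0.+1 + m).+1).
have := metric_triangle (a (i0.+1 + m)) (p (target (s i0.+1)))
  (p (r (i0.+1 + m).+1)).
move: qr; rewrite tE'; lra.
Qed.

End InfinitePursuit.
End Strategy.

Lemma two_cops_can_win : (forall m, exists x, p x = m) -> cops_can_win M 2.
Proof.
move=> p_surj tau [r0 c0] tau_agility.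
have [x px] := p_surj (c0 ord0); have [y py] := p_surj r0.
pose s0 := Pursuit y x (c0 ord_max) x 0.
have pos0 : (r0, c0) = positions s0.
  rewrite /positions /= py px; congr pair; apply/funext => i.
  by case: eqP => [->//|/eqP i0]; congr c0; apply/val_inj; case: i i0 => -[|[|]].
have [||sigma legal win] := @stateful_strategy _ M 2 tau _ positions
  (on_radius x) (pursuit_step tau x) s0 tau_agility.1.
- by rewrite /on_radius /= mdistxx add0r.
- by move=> i s r; exact: pursuit_step_exists.
exists sigma => // rho /win[s [s0E s_rad s_step posE]]; rewrite pos0.
apply: cops_win_play_close => e e0; apply: contrapT => far.
have clock0 : clock (s 0) = 0 by rewrite s0E.
apply: (pursuit_succeeds tau_agility clock0 s_rad s_step e0) => i.
split; rewrite leNgt; apply/negP => close; apply: far; exists i.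
  by exists ord0; rewrite posE.
by exists ord_max; rewrite posE.
Qed.

End Pursuit.

Theorem theorem1p6 (R : realType) (n : nat) (M : metricType R)
    (hn : (2 <= n)%N) (hM : compact_hyperbolic_manifold n M) :
  is_cop_win_number M 2.
Proof.
have [compactM [G [isoG freeG discG [p [p_surj p_orbit p_mdist]]]]] := hM.
split.
  have [D D0 DP] := manifold_bounded compactM.
  apply: (two_cops_can_win (projection_lipschitz isoG p_mdist) _ _ D0 DP) => //.
    exact: (lift_point isoG discG p_surj p_orbit p_mdist).
  exact: (geodesic_manifold isoG discG p_surj p_orbit p_mdist).
have [e e0 [escape0 escape]] := escape_single_pursuer isoG freeG discG compactM
  p_surj p_orbit p_mdist (ltnW hn).
have [m _] := escape0.
case=> [/(no_cop_cannot_win m)//|[|//]].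
by move/(one_cop_cannot_win e0 escape0 escape).
Qed.
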